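(* Let $q$ be a prime power, $G=PSL_2(q)$, and let $a$, $t$, $a_k$, $\alpha_r$ and, for $q$ odd, $b$, $b_\ell$, $\beta_r$ be as defined in the context. Then: (1) $a_k=\dfrac{\alpha_k(a)}{\alpha_{k-1}(a)}$ for $1\le k\le t-1$; (2) if $q$ is odd, $b_\ell=\dfrac{\beta_\ell(a,b)}{\beta_{\ell-1}(a,b)}$ for $0\le\ell\le t-1$; (3) $\alpha_k(a)=\prod_{i=1}^{k}a_i$ for $1\le k\le t-1$; (4) if $q$ is odd, $\beta_\ell(a,b)=\prod_{i=0}^{\ell}b_i$ for $0\le\ell\le t-1$.
   Context: $PSL_2(q)=SL_2(\mathbb{F}_q)/\{\pm I\}$. For $x\in\mathbb{F}_q$, $y\in\mathbb{F}_q^*$, $u(x)$, $h(y)$, $s$ denote the images in $PSL_2(q)$ of $\begin{pmatrix}1&x\\0&1\end{pmatrix}$, $\begin{pmatrix}y&0\\0&y^{-1}\end{pmatrix}$, $\begin{pmatrix}0&1\\-1&0\end{pmatrix}$. $B=\{u(x)h(y)\}$ is the image of the upper triangular matrices. Choice of $a,b,t$: $a\in\mathbb{F}_q$ is such that $\lambda^2-a\lambda+1$ is irreducible over $\mathbb{F}_q$ with a root of order $q+1$ in $\mathbb{F}_{q^2}^*$; $t=\frac{q+1}{\gcd(2,q+1)}$ (the order of $u(a)s$). If $q$ is odd, $b\in\mathbb{F}_q$ is such that $u(b)s\notin[u(a)s]^kB$ for all $0\le k<t$. Every $g\in PSL_2(q)\setminus B$ can be written $g=u(c)\,s\,u(x)\,h(y)$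 with a unique $c\in\mathbb{F}_q$. For $1\le k\le t-1$, $a_k$ is this $c$ for $g=[u(a)s]^k$; for $q$ odd and $0\le\ell\le t-1$, $b_\ell$ is this $c$ for $g=[u(a)s]^\ell[u(b)s\,u(-b)]$ (these elements do not lie in $B$). $\alpha_{-1}(a)=0$, and for $k\ge0$, $\alpha_k(a)=\sum_{i=0}^{\lfloor k/2\rfloor}(-1)^i\binom{k-i}{i}a^{k-2i}$ (the Dickson polynomial of the second kind $E_k(a,1)$). $\beta_{-1}(a,b)=1$ and $\beta_k(a,b)=b\,\alpha_k(a)-\alpha_{k-1}(a)$ for $k\ge0$. *)

(* Defs.v *)
From HB Require Import structures.
From mathcomp Require Import all_boot all_order all_algebra all_fingroup.
From mathcomp Require Import all_solvable all_field.

Set Implicit Arguments.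
Unset Strict Implicit.
Unset Printing Implicit Defensive.

Import GRing.Theory.
Local Open Scope ring_scope.

Section PSL2.

Variable F : finFieldType.

Definition mx2 (p q r s : F) : 'M[F]_2 :=
  \matrix_(i, j) if i == 0 then if j == 0 then p else q
                 else if j == 0 then r else s.

Lemma mx2E p q r s :
  (mx2 p q r s 0 0 = p) * (mx2 p q r s 0 1 = q) *
  (mx2 p q r s 1 0 = r) * (mx2 p q r s 1 1 = s).
Proof. by rewrite !mxE. Qed.

Lemma mx2P (A B : 'M[F]_2) :
  A 0 0 = B 0 0 -> A 0 1 = B 0 1 -> A 1 0 = B 1 0 -> A 1 1 = B 1 1 -> A = B.
Proof.
move=> h00 h01 h10 h11; apply/matrixP => i j.
have I2 (k : 'I_2) : k = 0 \/ k = 1.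
  by case: k => [[|[|k]] hk] //; [left | right]; apply: val_inj.
by case: (I2 i) => ->; case: (I2 j) => ->.
Qed.

Lemma mx2_eta (A : 'M[F]_2) : A = mx2 (A 0 0) (A 0 1) (A 1 0) (A 1 1).
Proof. by apply: mx2P; rewrite mx2E. Qed.

Lemma mul_mx2 p q r s p' q' r' s' :
  mx2 p q r s *m mx2 p' q' r' s' =
  mx2 (p * p' + q * r') (p * q' + q * s') (r * p' + s * r') (r * q' + s * s').
Proof.
by apply: mx2P; rewrite mx2E mxE big_ord_recl big_ord1 !mxE.
Qed.

Lemma det_mx2 p q r s : \det (mx2 p q r s) = p * s - q * r.
Proof.
rewrite (expand_det_row _ 0) big_ord_recl big_ord1 /cofactor !det_mx11 !mxE /=.
by rewrite expr0 mul1r expr1 mulN1r mulrN.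
Qed.

Lemma det1_unit (A : 'M[F]_2) : \det A = 1 -> A \is a GRing.unit.
Proof. by move=> dA; rewrite -[_ \is a _]/(A \in unitmx) unitmxE dA unitr1. Qed.

Definition gl_of_det1 (A : 'M[F]_2) (dA : \det A = 1) : {'GL_2[F]} :=
  FinRing.unit 'M[F]_2 (det1_unit dA).

Definition SL2 : {set {'GL_2[F]}} := [set g : {'GL_2[F]} | \det (GLval g) == 1].

Lemma SL2_group_set : group_set SL2.
Proof.
apply/group_setP; split=> [|g h]; rewrite !inE; first by rewrite det1.
by move=> /eqP dg /eqP dh; rewrite GL_MxE det_mulmx dg dh mulr1.
Qed.
Canonical SL2_group := Group SL2_group_set.

Definition pmI : {set {'GL_2[F]}} :=
  [set g : {'GL_2[F]} | (GLval g == 1) || (GLval g == -1)].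

Lemma pmI_group_set : group_set pmI.
Proof.
apply/group_setP; split=> [|g h]; rewrite !inE; first by rewrite eqxx.
rewrite GL_ME => /orP[]/eqP-> /orP[]/eqP->;
  by rewrite ?mulrNN ?mulr1 ?mul1r eqxx ?orbT.
Qed.
Canonical pmI_group := Group pmI_group_set.

Definition PSL2 : {group coset_of pmI} := (SL2 / pmI)%G.

Lemma u_det x : \det (mx2 1 x 0 1) = 1.
Proof. by rewrite det_mx2 mulr1 mulr0 subr0. Qed.

Lemma h_det (y : {unit F}) : \det (mx2 (val y) 0 0 (val y)^-1) = 1.
Proof. by rewrite det_mx2 mulr0 subr0 divrr // (valP y). Qed.

Lemma s_det : \det (mx2 0 1 (-1) 0) = 1.
Proof. by rewrite det_mx2 mulr0 mul1r sub0r opprK. Qed.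

Definition u (x : F) : coset_of pmI := coset pmI (gl_of_det1 (u_det x)).
Definition h (y : {unit F}) : coset_of pmI := coset pmI (gl_of_det1 (h_det y)).
Definition s : coset_of pmI := coset pmI (gl_of_det1 s_det).

Definition borel : {set coset_of pmI} :=
  [set (u x * h y)%g | x in [set: F], y in [set: {unit F}]].

(* The c in the factorization g = u(c) s u(x) h(y); the value 0 is a default
   used only when g has no such factorization. See bruhat_coordP. *)
Definition bruhat_coord (g : coset_of pmI) : F :=
  odflt 0 [pick c | [exists x : F, exists y : {unit F},
                       g == (u c * s * u x * h y)%g]].

Lemma pmI_norm : (SL2 \subset 'N(pmI))%g.
Proof.
apply: subset_trans (cent_sub _).
apply/subsetP=> g _; apply/centP=> z; rewrite inE => /orP[]/eqP zE;
  apply: val_inj; change (GLval g * GLval z = GLval z * GLval g);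
  by rewrite zE ?mulrN1 ?mulN1r ?mulr1 ?mul1r.
Qed.

Lemma gl_of_det1_SL2 A (dA : \det A = 1) : gl_of_det1 dA \in SL2.
Proof. by rewrite inE /= dA. Qed.

Lemma coset_gl_eq A B (dA : \det A = 1) (dB : \det B = 1) :
  (coset pmI (gl_of_det1 dA) == coset pmI (gl_of_det1 dB))
  = (A == B) || (A == - B).
Proof.
have nN C (dC : \det C = 1) := subsetP pmI_norm _ (gl_of_det1_SL2 dC).
apply/eqP/idP => [/(rcoset_kercosetP (nN _ _) (nN _ _))|].
  case/rcosetP=> z; rewrite inE => /orP[]/eqP zE /(congr1 (@GLval 2 F));
  by rewrite GL_ME zE /= ?mulN1r ?mul1r => ->; rewrite eqxx ?orbT.
move=> AB; apply/(rcoset_kercosetP (nN _ _) (nN _ _)).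
rewrite mem_rcoset inE GL_ME GL_VE /=.
have uB := det1_unit dB.
by case/orP: AB => /eqP->; rewrite ?mulNr divrr // eqxx ?orbT.
Qed.

Lemma coset_gl_mul A B (dA : \det A = 1) (dB : \det B = 1)
    (dAB : \det (A *m B) = 1) :
  (coset pmI (gl_of_det1 dA) * coset pmI (gl_of_det1 dB))%g
  = coset pmI (gl_of_det1 dAB).
Proof.
rewrite -morphM ?(subsetP pmI_norm) ?gl_of_det1_SL2 //.
by congr (coset _ _); apply: val_inj.
Qed.

Lemma PSL2P (g : coset_of pmI) :
  g \in PSL2 -> exists A (dA : \det A = 1), g = coset pmI (gl_of_det1 dA).
Proof.
case/morphimP=> z _; rewrite inE => /eqP dz ->; exists (GLval z), dz.
by congr (coset _ _); apply: val_inj.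
Qed.

Lemma borelE (x : F) (y : {unit F}) :
  exists dA : \det (mx2 (val y) (x / val y) 0 (val y)^-1) = 1,
    (u x * h y)%g = coset pmI (gl_of_det1 dA).
Proof.
have e : mx2 1 x 0 1 *m mx2 (val y) 0 0 (val y)^-1
         = mx2 (val y) (x / val y) 0 (val y)^-1.
  by rewrite mul_mx2 !(mul0r, mul1r, mulr0, addr0, add0r).
have dA := det_mulmx (mx2 1 x 0 1) (mx2 (val y) 0 0 (val y)^-1).
rewrite u_det h_det mul1r in dA.
by rewrite -e; exists dA; apply: coset_gl_mul.
Qed.

Lemma bruhatE (c x : F) (y : {unit F}) :
  exists dA : \det (mx2 (- (c * val y)) ((1 - c * x) / val y)
                        (- val y) (- (x / val y))) = 1,
    (u c * s * u x * h y)%g = coset pmI (gl_of_det1 dA).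
Proof.
have [dB eB] := borelE x y.
have e : mx2 1 c 0 1 *m mx2 0 1 (-1) 0
           *m mx2 (val y) (x / val y) 0 (val y)^-1
       = mx2 (- (c * val y)) ((1 - c * x) / val y)
             (- val y) (- (x / val y)).
  rewrite !mul_mx2; congr mx2;
  by rewrite ?(mul0r, mul1r, mulr0, mulr1, addr0, add0r, mulrN, mulNr) //
             mulrBl mul1r mulrA addrC.
have d1 : \det (mx2 1 c 0 1 *m mx2 0 1 (-1) 0) = 1.
  by rewrite det_mulmx u_det s_det mulr1.
rewrite -e; have d2 : \det (mx2 1 c 0 1 *m mx2 0 1 (-1) 0
           *m mx2 (val y) (x / val y) 0 (val y)^-1) = 1.
  by rewrite det_mulmx d1 dB mulr1.
exists d2; rewrite -mulgA eB -(coset_gl_mul d1 dB).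
by congr (_ * _)%g; apply: coset_gl_mul.
Qed.

(* Existence and uniqueness of c for g outside the Borel subgroup. *)
Lemma bruhat_coordP (g : coset_of pmI) (c : F) :
  g \in PSL2 -> g \notin borel ->
  (exists x y, g = (u c * s * u x * h y)%g) <-> c = bruhat_coord g.
Proof.
case/PSL2P=> A [dA gE] gB.
have dE : A 0 0 * A 1 1 - A 0 1 * A 1 0 = 1 by rewrite -det_mx2 -mx2_eta.
have A10 : A 1 0 != 0.
  apply/negP=> /eqP A10; case/negP: gB; rewrite gE.
  have A00 : A 0 0 * A 1 1 = 1 by rewrite -dE A10 mulr0 subr0.
  have nz : A 0 0 != 0.
    by apply: contra_eq_neq A00 => ->; rewrite mul0r eq_sym oner_neq0.
  have uA : A 0 0 \is a GRing.unit by rewrite unitfE.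
  pose y := FinRing.unit F uA.
  apply/imset2P; exists (A 0 1 * A 0 0) y; rewrite ?inE //.
  have [dB ->] := borelE (A 0 1 * A 0 0) y.
  apply/eqP; rewrite coset_gl_eq /= mulfK // -[in X in _ == X]A10.
  have <- : A 1 1 = (A 0 0)^-1 by apply: (mulfI nz); rewrite A00 divff.
  by rewrite -mx2_eta eqxx.
have uniq_c c' x y : g = (u c' * s * u x * h y)%g -> c' = A 0 0 / A 1 0.
  have [dB ->] := bruhatE c' x y; rewrite gE => /eqP; rewrite coset_gl_eq.
  case/orP=> /eqP AE; apply: (mulIf A10); rewrite divfK //;
  by rewrite AE !mxE /= ?opprK ?mulrN.
have ex_c : exists x y, g = (u (A 0 0 / A 1 0)%R * s * u x * h y)%g.
  have uA : - A 1 0 \is a GRing.unit by rewrite unitfE oppr_eq0.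
  exists (A 1 1 * A 1 0), (FinRing.unit F uA).
  have [dB ->] := bruhatE (A 0 0 / A 1 0) (A 1 1 * A 1 0) (FinRing.unit F uA).
  apply/eqP; rewrite gE coset_gl_eq /=; apply/orP; left; apply/eqP.
  apply: mx2P; rewrite mx2E //.
  - by rewrite mulrN opprK divfK.
  - have -> : A 0 0 / A 1 0 * (A 1 1 * A 1 0) = A 0 0 * A 1 1.
      by rewrite mulrA mulrAC divfK.
    by rewrite -dE addrAC subrr add0r invrN mulrNN mulfK.
  - by rewrite opprK.
  - by rewrite invrN mulrN opprK mulfK.
have -> : bruhat_coord g = A 0 0 / A 1 0.
  rewrite /bruhat_coord; case: pickP => [c' /existsP[x /existsP[y /eqP]]|no].
    exact: uniq_c.
  have [x [y gxy]] := ex_c; have /negP[] := negbT (no (A 0 0 / A 1 0)).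
  by apply/existsP; exists x; apply/existsP; exists y; rewrite -gxy.
by split=> [[x [y]]|->//]; apply: uniq_c.
Qed.

(* The order of u a * s when 'X^2 - a *: 'X + 1 is irreducible over F with a
   root of multiplicative order #|F|.+1. *)
Definition torus_order : nat := (#|F|.+1 %/ gcdn 2 #|F|.+1)%N.

Definition a_ (a : F) (k : nat) : F := bruhat_coord ((u a * s) ^+ k)%g.

Definition b_ (a b : F) (l : nat) : F :=
  bruhat_coord ((u a * s) ^+ l * (u b * s * u (- b)))%g.

End PSL2.

(* alpha (-1) x = 0; the other negative indices are never used. *)
Definition alpha (F : fieldType) (k : int) (x : F) : F :=
  if k is Posz n then
    \sum_(i < n./2.+1) (-1) ^+ i * 'C(n - i, i)%:R * x ^+ (n - i.*2)
  else 0.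

(* beta (-1) x y = 1; the other negative indices are never used. *)
Definition beta (F : fieldType) (k : int) (x y : F) : F :=
  if k is Posz _ then y * alpha k x - alpha (k - 1) x else 1.

(* Main.v *)
(* In PSL_2 the element u(a)s is represented by the matrix (a -1; 1 0), so its
   powers have entries +-alpha, the Dickson recurrence being multiplication by
   this matrix. The coordinate c of a matrix is the ratio of the entries of its
   first column, and the products in (3) and (4) telescope. If z is a root of
   X^2 - aX + 1, then alpha_k = (z^(k+1) - z^-(k+1)) / (z - z^-1), so alpha_(k-1)
   vanishes exactly when q+1 divides 2k; this gives both alpha_(k-1) <> 0 for
   0 < k < t and (u(a)s)^t = 1. If beta_(l-1) = 0, then (u(a)s)^l u(b)s lies in B,
   whence u(b)s lies in (u(a)s)^(t-l) B, which the choice of b excludes. *)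
Require Import Defs.
From mathcomp Require Import all_boot all_order all_algebra all_fingroup.
From mathcomp Require Import all_solvable all_field.
From mathcomp Require Import zify ring.

Set Implicit Arguments.
Unset Strict Implicit.
Unset Printing Implicit Defensive.

Import GRing.Theory.
Local Open Scope ring_scope.

Lemma natz_pred (k : nat) : k.+1%:Z - 1 = k%:Z.
Proof. by rewrite -addn1 PoszD addrK. Qed.

(** * Dickson polynomials of the second kind *)

Section Dickson.

Variable F : fieldType.
Implicit Types x y : F.

(** For i > n/2 the binomial C(n-i, i) is zero. A longer common range lets sums of different degrees
    be compared termwise. *)
Lemma alpha_widen n N x : (n./2 < N)%N ->
  alpha n%:Z x
  = \sum_(0 <= i < N) (-1) ^+ i * 'C(n - i, i)%:R * x ^+ (n - i.*2).
Proof.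
move=> nN; rewrite (big_cat_nat _ (n := n./2.+1)) //= -[LHS]addr0.
congr (_ + _); first by rewrite big_mkord.
rewrite big_nat_cond big1 // => i; rewrite andbT => /andP[ni _].
by rewrite bin_small ?mulr0 ?mul0r //; lia.
Qed.

Lemma alpha0 x : alpha 0%:Z x = 1.
Proof. by rewrite /alpha big_ord1 !mul1r. Qed.

Lemma alpha1 x : alpha 1%:Z x = x.
Proof. by rewrite /alpha big_ord1 !mul1r. Qed.

(** Pascal's rule applied to C(n+1-i, i+1), once the leading terms are split off. *)
Lemma alphaSS n x :
  alpha n.+2%:Z x = x * alpha n.+1%:Z x - alpha n%:Z x.
Proof.
rewrite (@alpha_widen n.+2 n.+3) ?(@alpha_widen n.+1 n.+3)
  ?(@alpha_widen n n.+2); [|lia..].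
rewrite big_nat_recl // [in X in x * X]big_nat_recl // mulrDr -addrA.
congr (_ + _); first by rewrite !bin0 !expr0 !mul1r !subn0 -exprS.
rewrite mulr_sumr -sumrB; apply: eq_big_nat => i /andP[_ ilt].
(* At i = n+1 the truncated n - i breaks the index shifts below, but all three binomials vanish. *)
have [iE|ile] : i = n.+1 \/ (i <= n)%N by lia.
  rewrite !bin_small; [|lia..].
  by rewrite !(mulr0, mul0r) subr0.
have -> : (n.+2 - i.+1 = (n - i).+1)%N by lia.
have -> : (n.+1 - i.+1 = n - i)%N by lia.
have -> : (n.+2 - i.+1.*2 = n - i.*2)%N by lia.
rewrite binS natrD mulrDr mulrDl exprS mulN1r; congr (_ + _); last first.
  by rewrite !mulNr.
have [lt|le] := ltnP (n - i) i.+1.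
  by rewrite bin_small // !(mulr0, mul0r).
have -> : (n - i.*2 = (n.+1 - i.+1.*2).+1)%N by lia.
by rewrite exprS mulrCA.
Qed.

Lemma alphaS_int n x :
  alpha n.+1%:Z x = x * alpha n%:Z x - alpha (n%:Z - 1) x.
Proof.
case: n => [|n]; first by rewrite alpha1 alpha0 mulr1 subr0.
by rewrite natz_pred alphaSS.
Qed.

Lemma betaS n x y :
  beta n.+1%:Z x y = y * alpha n.+1%:Z x - alpha n%:Z x.
Proof. by rewrite /beta natz_pred. Qed.

Lemma beta0 x y : beta 0%:Z x y = y.
Proof. by rewrite /beta alpha0 mulr1 subr0. Qed.

(** The closed form of alpha_k multiplied by z^(k+1) (z - z^-1), free of inverses. The recurrence
    has order two, so the induction carries two consecutive indices. *)
Lemma alpha_root (L : fieldExtType F) (a : F) (z : L) k :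
  z ^+ 2 - a%:A * z + 1 = 0 ->
  (alpha k%:Z a)%:A * (z ^+ 2 - 1) * z ^+ k = z ^+ k.+1.*2 - 1.
Proof.
move=> z_root.
have azE : a%:A * z = z ^+ 2 + 1 by rewrite -[LHS]addr0 -z_root; ring.
suff: (alpha k%:Z a)%:A * (z ^+ 2 - 1) * z ^+ k = z ^+ k.+1.*2 - 1 /\
   (alpha k.+1%:Z a)%:A * (z ^+ 2 - 1) * z ^+ k.+1 = z ^+ k.+2.*2 - 1 by case.
elim: k => [|k [IH0 IH1]].
  rewrite alpha0 alpha1 scale1r mul1r mulr1; split=> //.
  rewrite expr1 mulrAC azE; ring.
split=> //; rewrite alphaSS scalerBl -scalerA -mulr_algl.
(* With w_k = z^(2k+2) - 1, this is w_(k+2) = (z^2 + 1) w_(k+1) - z^2 w_k, where az = z^2 + 1. *)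
have -> : z ^+ k.+3.*2 - 1 = a%:A * z * (z ^+ k.+2.*2 - 1)
                              - z ^+ 2 * (z ^+ k.+1.*2 - 1).
  by rewrite azE !doubleS !exprS; ring.
by rewrite -IH0 -IH1 !exprS; ring.
Qed.

End Dickson.

(** * Matrix representatives of elements of PSL_2 *)

Section Representatives.

Variable F : finFieldType.
Implicit Types (g : coset_of (pmI F)) (A : 'M[F]_2).

(** The determinant proof sits under an existential, so that A can be rewritten freely. *)
Definition represents A g : Prop :=
  exists dA : \det A = 1, g = coset (pmI F) (gl_of_det1 dA).

Lemma represents_mul A1 A2 g1 g2 :
  represents A1 g1 -> represents A2 g2 -> represents (A1 *m A2) (g1 * g2)%g.
Proof.
move=> [d1 ->] [d2 ->].
have d12 : \det (A1 *m A2) = 1 by rewrite det_mulmx d1 d2 mulr1.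
by exists d12; rewrite (coset_gl_mul d1 d2 d12).
Qed.

Lemma representsN A g : represents A g -> represents (- A) g.
Proof.
move=> [dA ->].
have dN : \det (- A) = 1 by rewrite -scaleN1r detZ sqrrN expr1n mul1r.
by exists dN; apply/eqP; rewrite coset_gl_eq opprK eqxx orbT.
Qed.

Lemma represents1 : represents 1 1%g.
Proof.
have d1 : \det (1 : 'M[F]_2) = 1 by rewrite det1.
exists d1; rewrite -(morph1 (coset_morphism (pmI F))).
by congr (coset _ _); apply: val_inj.
Qed.

Lemma represents_inj A g1 g2 : represents A g1 -> represents A g2 -> g1 = g2.
Proof.
by move=> [d1 ->] [d2 ->]; apply/eqP; rewrite coset_gl_eq eqxx.
Qed.

Lemma represents_borel A g : represents A g -> (g \in borel F) = (A 1 0 == 0).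
Proof.
move=> [dA gE].
have dE : A 0 0 * A 1 1 - A 0 1 * A 1 0 = 1 by rewrite -det_mx2 -mx2_eta.
apply/imset2P/eqP => [[x y _ _]|A10].
  have [dB ->] := borelE x y; rewrite gE => /eqP; rewrite coset_gl_eq.
  by case/orP=> /eqP->; rewrite !mxE ?oppr0.
have A00 : A 0 0 * A 1 1 = 1 by rewrite -dE A10 mulr0 subr0.
have nz : A 0 0 != 0.
  by apply: contra_eq_neq A00 => ->; rewrite mul0r eq_sym oner_neq0.
have uA : A 0 0 \is a GRing.unit by rewrite unitfE.
(* The upper right entry of u(x)h(y) is x/y; with y = A_00 this forces x = A_01 A_00. *)
exists (A 0 1 * A 0 0) (FinRing.unit F uA) => //.
have [dB ->] := borelE (A 0 1 * A 0 0) (FinRing.unit F uA).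
rewrite gE; apply/eqP; rewrite coset_gl_eq /= mulfK //.
have <- : A 1 1 = (A 0 0)^-1 by apply: (mulfI nz); rewrite A00 divff.
by rewrite -[in X in mx2 _ _ X _]A10 -mx2_eta eqxx.
Qed.

(** The first column of u(c)su(x)h(y) is -y(c, 1), and its ratio c does not see the sign of the
    lift. *)
Lemma represents_bruhat_coord A g :
  represents A g -> A 1 0 != 0 -> bruhat_coord g = A 0 0 / A 1 0.
Proof.
move=> gA A10; have gB : g \notin borel F by rewrite (represents_borel gA).
have [dA gE] := gA.
have gG : g \in PSL2 F.
  by rewrite gE mem_morphim ?gl_of_det1_SL2 //
             (subsetP (pmI_norm F)) ?gl_of_det1_SL2.
have [_ /(_ erefl)] := bruhat_coordP (bruhat_coord g) gG gB.
move: (bruhat_coord g) => c [x [y gxy]].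
have [dB eB] := bruhatE c x y.
move: gxy; rewrite eB gE => /eqP; rewrite coset_gl_eq => AE.
apply: (mulIf A10); rewrite divfK //.
by case/orP: AE => /eqP->; rewrite !mxE /= ?mulrN ?mulNr.
Qed.

Lemma represents_us a : represents (mx2 a (-1) 1 0) (u a * s F)%g.
Proof.
have us := represents_mul (ex_intro _ (u_det a) erefl)
                          (ex_intro _ (s_det F) erefl).
have -> : mx2 a (-1) 1 0 = - (mx2 1 a 0 1 *m mx2 0 1 (-1) 0).
  rewrite mul_mx2; apply: mx2P; rewrite !mxE /=; ring.
exact: representsN us.
Qed.

(** Left multiplication by (a -1; 1 0) moves the first row down and puts the next terms of the
    recurrence above it. *)
Lemma represents_us_exp a k :
  represents (mx2 (alpha k.+1%:Z a) (- alpha k%:Z a)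
                  (alpha k%:Z a) (- alpha (k%:Z - 1) a))
             ((u a * s F) ^+ k.+1)%g.
Proof.
elim: k => [|k IHk].
  by rewrite alpha1 alpha0 /= oppr0 expg1; apply: represents_us.
have := represents_mul (represents_us a) IHk.
rewrite mul_mx2 -expgS natz_pred; congr (represents (mx2 _ _ _ _) _);
  by rewrite ?alphaSS ?alphaS_int; ring.
Qed.

End Representatives.

(** Division by 0 returns 0 here, so (1) and (2) also assert that the denominators are nonzero. *)
Theorem theorem2p8 (F : finFieldType) (L : fieldExtType F)
    (dimL : \dim {:L} = 2%N) (a b : F)
    (a_irr : irreducible_poly ('X^2 - a *: 'X + 1))
    (a_root : exists2 z : L, root (map_poly (in_alg L) ('X^2 - a *: 'X + 1)) z
                           & (#|F|.+1).-primitive_root z)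
    (b_coset : odd #|F| -> forall k : nat, (k < torus_order F)%N ->
       (u b * s F)%g \notin ((u a * s F) ^+ k *: borel F)%g) :
  [/\ forall k : nat, (1 <= k <= torus_order F - 1)%N ->
        alpha (k%:Z - 1) a != 0
        /\ a_ a k = alpha k%:Z a / alpha (k%:Z - 1) a,
      odd #|F| -> forall l : nat, (l <= torus_order F - 1)%N ->
        beta (l%:Z - 1) a b != 0
        /\ b_ a b l = beta l%:Z a b / beta (l%:Z - 1) a b,
      forall k : nat, (1 <= k <= torus_order F - 1)%N ->
        alpha k%:Z a = \prod_(1 <= i < k.+1) a_ a i
    & odd #|F| -> forall l : nat, (l <= torus_order F - 1)%N ->
        beta l%:Z a b = \prod_(0 <= i < l.+1) b_ a b i].
Proof.
set q := #|F| in a_root b_coset *; set t := torus_order F in b_coset *.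
have q_gt1 : (1 < q)%N by apply: finNzRing_gt1.
(* t is the least positive k such that q+1 divides 2k. *)
have [t_gt0 dvd_t lt_t] : [/\ (0 < t)%N, q.+1 %| t.*2
    & forall k, (0 < k < t)%N -> ~~ (q.+1 %| k.*2)]%N.
  rewrite /t /torus_order -/q.
  have tg := divnK (dvdn_gcdr 2 q.+1).
  have := dvdn_gcdl 2 q.+1; rewrite (@dvdn_divisors _ 2) // !inE.
  case/orP=> /eqP gE; rewrite gE in tg *.
  - rewrite divn1; split=> //; first by rewrite -mul2n dvdn_mull.
    move=> k /andP[k0 kt]; rewrite -mul2n Gauss_dvdr; last first.
      by rewrite coprime_sym /coprime gE.
    by rewrite gtnNdvd.
  - split; [lia | by rewrite -muln2 tg |].
    by move=> k /andP[k0 kt]; rewrite gtnNdvd //; lia.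
have alpha_eq0 k : (alpha k%:Z a == 0) = (q.+1 %| k.+1.*2)%N.
  have [z z_root z_prim] := a_root.
  have zE : z ^+ 2 - a%:A * z + 1 = 0.
    move: z_root; rewrite /root => /eqP.
    rewrite rmorphD rmorphB /= map_polyXn map_polyZ map_polyX rmorph1.
    by rewrite !hornerE.
  rewrite (prim_order_dvd z_prim) -[RHS]subr_eq0 -(alpha_root k zE).
  have z0 : z != 0.
    apply: contra_eq_neq (prim_expr_order z_prim) => ->.
    by rewrite expr0n eq_sym oner_neq0.
  rewrite !mulf_eq0 [z ^+ k == 0]expf_eq0 (negPf z0) andbF orbF scaler_eq0.
  (* z^2 = 1 would make q+1 divide 2, against q > 1. *)
  rewrite oner_eq0 orbF subr_eq0 -(prim_order_dvd z_prim) gtnNdvd ?orbF //.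
have alpha_neq0 k : (k.+1 < t)%N -> alpha k%:Z a != 0.
  by move=> kt; rewrite alpha_eq0 lt_t.
have aE k : (k.+1 < t)%N -> a_ a k.+1 = alpha k.+1%:Z a / alpha k%:Z a.
  move=> kt; have := represents_bruhat_coord (represents_us_exp a k).
  by rewrite !mx2E /a_ => ->; rewrite // alpha_neq0.
(* As alpha_(t-1) = 0, the matrix of the power is alpha_t I, and determinant 1 makes it I or -I. *)
have us_t : ((u a * s F) ^+ t = 1)%g.
  have /eqP at0 : alpha t.-1%:Z a == 0 by rewrite alpha_eq0 prednK.
  have := represents_us_exp a t.-1; rewrite prednK // at0 oppr0.
  have -> : - alpha (t.-1%:Z - 1) a = alpha t%:Z a.
    by rewrite -[in RHS](prednK t_gt0) alphaS_int at0 mulr0 add0r.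
  set c := alpha t%:Z a => rep_t; have [d_t _] := rep_t.
  move: d_t; rewrite det_mx2 mulr0 subr0 -expr2 => /eqP.
  have rep1 : represents (mx2 1 0 0 1) (1%g : coset_of (pmI F)).
    have -> : mx2 1 0 0 1 = 1 :> 'M[F]_2 by apply: mx2P; rewrite !mxE.
    exact: represents1.
  rewrite sqrf_eq1 => /orP[]/eqP cE; rewrite cE in rep_t.
    exact: represents_inj rep_t rep1.
  apply: represents_inj (representsN rep_t) _.
  have -> : - mx2 (-1) 0 0 (-1) = mx2 1 0 0 1 :> 'M[F]_2.
    by apply: mx2P; rewrite !mxE /= ?opprK ?oppr0.
  exact: rep1.
have beta_neq0 l : odd q -> (l < t)%N -> beta (l%:Z - 1) a b != 0.
  move=> q_odd lt; case: l lt => [|l] lt; first exact: oner_neq0.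
  (* This bound needs a positive index; index 0 was settled by beta_(-1) = 1. *)
  have kt : (t - l.+1 < t)%N by lia.
  apply: contra (b_coset q_odd _ kt); rewrite natz_pred => /eqP bl0.
  have inv_us : ((u a * s F) ^- (t - l.+1) = (u a * s F) ^+ l.+1)%g.
    apply/eqP; rewrite eq_invg_mul -expgD subnK ?us_t //; lia.
  rewrite mem_lcoset inv_us.
  rewrite (represents_borel (represents_mul (represents_us_exp a l)
                                            (represents_us b))).
  (* The lower left entry is b alpha_l - alpha_(l-1) = beta_l. *)
  rewrite mul_mx2 mx2E mulr1 mulrC.
  by move: bl0; rewrite /beta => ->.
have bE l : odd q -> (l < t)%N ->
    b_ a b l = beta l%:Z a b / beta (l%:Z - 1) a b.
  move=> q_odd lt; have bn0 := beta_neq0 l q_odd lt.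
  (* The factor u(-b) keeps the first column (b, 1) of u(b)s, which [u(a)s]^l sends to (beta_l,
     beta_(l-1)). *)
  have rep_b := represents_mul (represents_us b)
                               (ex_intro _ (u_det (- b)) erefl).
  rewrite mul_mx2 !(mul0r, mulr0, mul1r, mulr1, addr0) in rep_b.
  rewrite /b_; case: l lt bn0 => [|l] lt bn0.
    rewrite expg0 mul1g (represents_bruhat_coord rep_b) !mx2E ?oner_neq0 //.
    by rewrite beta0.
  have := represents_bruhat_coord
    (represents_mul (represents_us_exp a l) rep_b).
  rewrite mul_mx2 !mx2E natz_pred betaS !mulr1 ![_ * b]mulrC.
  by apply; move: bn0; rewrite natz_pred.
split.
- case=> [|k] // kt; rewrite natz_pred.
  have kt' : (k.+1 < t)%N by lia.
  by split; [apply: alpha_neq0 | apply: aE].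
- move=> q_odd l lt; have lt' : (l < t)%N by lia.
  by split; [apply: beta_neq0 | apply: bE].
- move=> k /andP[k0 kt]; rewrite big_add1 /=.
  rewrite (@telescope_prodf_eq _ _ _ (fun i => alpha i%:Z a)) //.
  + by rewrite alpha0 divr1.
  + by move=> i ik; apply: alpha_neq0; lia.
  + by move=> i ik; apply: aE; lia.
- move=> q_odd l lt.
  (* The shift by one makes the product telescope to beta_l / beta_(-1), with beta_(-1) = 1. *)
  rewrite (@telescope_prodf_eq _ _ _ (fun i => beta (i%:Z - 1) a b)) //.
  + by rewrite natz_pred divr1.
  + by move=> i il; apply: beta_neq0 => //; lia.
  + by move=> i il; rewrite natz_pred; apply: bE => //; lia.
Qed.
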